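(* Let $r\in\mathbb Z$ and suppose $q_{0,1}=q_{1,2}$ and $q_{1,1}=q_{0,2}$. Let $n\in\mathbb N_0$ and $s,\tilde j,\tilde k\in\mathbb Z$. If $\tilde j<r$, then $$g(r,s;2n+2\,|\,\tilde j,\tilde k)=q_{0,0}\Big\{q_{1,2}\left[p_{r-1,s}(2n\,|\,\tilde j,\tilde k)-p_{r+1,s-1}(2n\,|\,\tilde j,\tilde k)\right]+q_{1,1}\left[p_{r-1,s+1}(2n\,|\,\tilde j,\tilde k)-p_{r+1,s}(2n\,|\,\tilde j,\tilde k)\right]\Big\}.$$ If $\tilde j>r$, then $$g(r,s;2n+2\,|\,\tilde j,\tilde k)=q_{1,0}\Big\{q_{0,2}\left[p_{r+1,s}(2n\,|\,\tilde j,\tilde k)-p_{r-1,s+1}(2n\,|\,\tilde j,\tilde k)\right]+q_{0,1}\left[p_{r+1,s-1}(2n\,|\,\tilde j,\tilde k)-p_{r-1,s}(2n\,|\,\tilde j,\tilde k)\right]\Big\}.$$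
   Context: Fix $a>0$ and nonnegative numbers $q_{i,r}$ ($i=0,1$; $r=0,1,2$) with $\sum_{r=0}^2 q_{i,r}=1$ for $i=0,1$. The vertices of the hexagonal lattice are $\mathscr V_0\cup\mathscr V_1$, where $$\mathscr V_i=\left\{\left(\tfrac32 aj+ia,\ \tfrac{\sqrt3}{2}aj+\sqrt3 ak\right): j,k\in\mathbb Z\right\},\quad i=0,1.$$ $\{(X_n,Y_n):n\in\mathbb N_0\}$ is the time-homogeneous Markov chain on $\mathscr V_0\cup\mathscr V_1$ which, from a vertex $(x,y)\in\mathscr V_i$, moves in one step to $\left(x+a\cos(\tfrac{2\pi l}{3}+i\pi),\ y+a\sin(\tfrac{2\pi l}{3}+i\pi)\right)$ with probability $q_{i,l}$, $l=0,1,2$ (such a point belongs to $\mathscr V_{1-i}$). For $\tilde j,\tilde k\in\mathbb Z$, $\mathbb P_0$ denotes the probability conditional on the initial state $(X_0,Y_0)=\left(\tfrac32a\tilde j,\ \tfrac{\sqrt3}{2}a\tilde j+\sqrt3a\tilde k\right)\in\mathscr V_0$. With $i_n=\frac12(1-(-1)^n)$, for $n\in\mathbb N_0$ and $j,k\in\mathbb Z$ put $$p_{j,k}(n\,|\,\tilde j,\tilde k)=\mathbb P_0\left[(X_n,Y_n)=\left(\tfrac32aj+i_na,\ \tfrac{\sqrt3}{2}aj+\sqrt3ak\right)\right].$$ For $r\in\mathbb Z$ the boundary is $\mathcal B_r=\left\{\left(\tfrac32ar,\ \tfrac{\sqrt3}{2}ar+\sqrt3ak\right):k\in\mathbb Z\right\}$.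 For an initial state not in $\mathcal B_r$, the first-passage time is $T_r(\tilde j,\tilde k)=\min\{n\in\mathbb N:(X_n,Y_n)\in\mathcal B_r\}$ ($=\infty$ if there is no such $n$), and for $n\in\mathbb N$, $s\in\mathbb Z$ the first-passage-time probabilities are $$g(r,s;n\,|\,\tilde j,\tilde k)=\mathbb P_0\left[T_r(\tilde j,\tilde k)=n,\ (X_n,Y_n)=\left(\tfrac32ar,\ \tfrac{\sqrt3}{2}ar+\sqrt3as\right)\right].$$ *)

(* Defs.v *)
From HB Require Import structures.
From mathcomp Require Import all_boot all_order all_algebra.
From mathcomp Require Import all_classical all_reals all_analysis.
Set Implicit Arguments.
Unset Strict Implicit.
Unset Printing Implicit Defensive.
Import Order.TTheory GRing.Theory Num.Theory.
Import numFieldNormedType.Exports.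
Local Open Scope classical_set_scope.
Local Open Scope ring_scope.

(* Equal to 0 when [P B = 0], so every hypothesis below that uses it assumes
   that the conditioning event has positive probability. *)
Definition cond_prob d (T : measurableType d) (R : realType)
    (P : probability T R) (A B : set T) : R :=
  fine (P (A `&` B)) / fine (P B).

(* [e] is the horizontal offset in units of [a]: 0 on V_0 and 1 on V_1. *)
Definition hex_point (R : realType) (a e : R) (j k : int) : R * R :=
  (3 / 2 * a * j%:~R + e * a,
   Num.sqrt 3 / 2 * a * j%:~R + Num.sqrt 3 * a * k%:~R).

Definition hex_vertices (R : realType) (a : R) (i : 'I_2) : set (R * R) :=
  [set z | exists j k : int, z = hex_point a (i : nat)%:R j k].

Definition hex_neighbor (R : realType) (a : R) (i : 'I_2) (l : 'I_3)
    (z : R * R) : R * R :=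
  (z.1 + a * cos (2 * pi * (l : nat)%:R / 3 + (i : nat)%:R * pi),
   z.2 + a * sin (2 * pi * (l : nat)%:R / 3 + (i : nat)%:R * pi)).

Definition at_state d (T : measurableType d) (R : realType)
    (P : probability T R) (X Y : nat -> {RV P >-> R}) (n : nat) (z : R * R) :
    set T :=
  [set w | (X n w, Y n w) = z].

Definition history d (T : measurableType d) (R : realType)
    (P : probability T R) (X Y : nat -> {RV P >-> R}) (n : nat)
    (z : nat -> R * R) : set T :=
  [set w | forall m, (m <= n)%N -> at_state X Y m (z m) w].

Record hex_markov_chain d (T : measurableType d) (R : realType)
    (P : probability T R) (a : R) (q : 'I_2 -> 'I_3 -> R)
    (X Y : nat -> {RV P >-> R}) : Prop := HexMarkovChain {
  hex_state_space : forall n w,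
    (hex_vertices a ord0 `|` hex_vertices a ord_max) (X n w, Y n w);
  hex_markov_property : forall n (z : nat -> R * R) (z' : R * R),
    (0 < P (history X Y n z))%E ->
    cond_prob P (at_state X Y n.+1 z') (history X Y n z) =
    cond_prob P (at_state X Y n.+1 z') (at_state X Y n (z n));
  hex_transition : forall n (i : 'I_2) (l : 'I_3) (z : R * R),
    hex_vertices a i z -> (0 < P (at_state X Y n z))%E ->
    cond_prob P (at_state X Y n.+1 (hex_neighbor a i l z)) (at_state X Y n z) =
    q i l }.

Definition initial_event d (T : measurableType d) (R : realType)
    (P : probability T R) (a : R) (X Y : nat -> {RV P >-> R}) (jt kt : int) :
    set T :=
  at_state X Y 0 (hex_point a 0 jt kt).

Definition hex_prob0 d (T : measurableType d) (R : realType)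
    (P : probability T R) (a : R) (X Y : nat -> {RV P >-> R}) (jt kt : int)
    (A : set T) : R :=
  cond_prob P A (initial_event a X Y jt kt).

Definition parity (R : realType) (n : nat) : R := (1 - (-1) ^+ n) / 2.

Definition state_prob d (T : measurableType d) (R : realType)
    (P : probability T R) (a : R) (X Y : nat -> {RV P >-> R})
    (j k : int) (n : nat) (jt kt : int) : R :=
  hex_prob0 a X Y jt kt (at_state X Y n (hex_point a (parity R n) j k)).

Definition hex_boundary (R : realType) (a : R) (r : int) : set (R * R) :=
  [set z | exists k : int, z = hex_point a 0 r k].

(* The infimum of the empty set is +oo. *)
Definition first_passage_time d (T : measurableType d) (R : realType)
    (P : probability T R) (a : R) (X Y : nat -> {RV P >-> R}) (r : int)
    (w : T) : \bar R :=
  ereal_inf [set (n%:R)%:E | n in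
    [set n : nat | (0 < n)%N /\ hex_boundary a r (X n w, Y n w)]].

Definition first_passage_prob d (T : measurableType d) (R : realType)
    (P : probability T R) (a : R) (X Y : nat -> {RV P >-> R})
    (r s : int) (n : nat) (jt kt : int) : R :=
  hex_prob0 a X Y jt kt
    ([set w | first_passage_time a X Y r w = (n%:R)%:E] `&`
     at_state X Y n (hex_point a 0 r s)).

(* Main.v *)
(* Two steps of the walk lead from the sublattice V_0 to itself. The hypotheses
   on q, with the normalization of its rows, force q 0 0 = q 1 0, and then the
   two-step kernel on V_0 commutes with the reflection in the boundary column.
   By the reflection principle, the law of the walk killed on the boundary is,
   on the side of the starting point, the free law minus its mirror image. A
   first passage at time 2n+2 is a killed path of length 2n followed by two
   steps that lead to the boundary. *)
Require Import Defs.
From HB Require Import structures.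
From mathcomp Require Import all_boot all_order all_algebra.
From mathcomp Require Import all_classical all_reals all_analysis.
From mathcomp Require Import zify ring lra.
Import Order.TTheory GRing.Theory Num.Theory.
Import numFieldNormedType.Exports.
Local Open Scope classical_set_scope.
Local Open Scope ring_scope.

(** * Integer coordinates on the hexagonal lattice *)

Section Geometry.
Context {R : realType}.

(** The triple-angle formula for [cos pi = -1] reads [(c + 1) * (2 * c - 1) ^+ 2 = 0], and
    positivity of [c] excludes the root -1. *)
Lemma cos_pi_third : cos (pi / 3) = 1 / 2 :> R.
Proof.
set c := cos _; have pi_gt0 := pi_gt0 R.
have c_gt0 : 0 < c by apply: cos_gt0_pihalf; apply/andP; split; lra.
have : cos (pi / 3 *+ 2 + pi / 3) = -1 :> R.
  by rewrite -cospi; congr cos; field.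
rewrite cosD cos_mulr2n sin_mulr2n -/c => h.
have := sin2cos2 (pi / 3 : R); rewrite -/c => h'.
have : (c + 1) * (2 * c - 1) ^+ 2 = 0.
  have -> : (c + 1) * (2 * c - 1) ^+ 2
      = (c ^+ 2 *+ 2 - 1) * c - c *+ 2 * (1 - c ^+ 2) + 1 by ring.
  by rewrite -h' expr2 (mulrA (c *+ 2)) mulrnAl -mulrnAl mulrnAl h addNr.
move/eqP; rewrite mulf_eq0 sqrf_eq0 => /orP[] /eqP; lra.
Qed.

Lemma sin_pi_third : sin (pi / 3) = Num.sqrt 3 / 2 :> R.
Proof.
have pi_gt0 := pi_gt0 R.
have s_ge0 : 0 <= sin (pi / 3 : R) by apply: sin_ge0_pi; apply/andP; split; lra.
have t_ge0 : 0 <= Num.sqrt 3 :> R by exact: sqrtr_ge0.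
apply/eqP; rewrite -(@eqrXn2 _ 2) ?divr_ge0 //.
rewrite sin2cos2 cos_pi_third !expr_div_n sqr_sqrtr //.
by apply/eqP; field.
Qed.

Definition hex_code : Type := (bool * (int * int))%type.

Definition sublattice (b : bool) : 'I_2 := if b then 1 else 0.

Definition vertex (a : R) (c : hex_code) : R * R :=
  hex_point a (c.1%:R) c.2.1 c.2.2.

(** Displacement of the indices alone: V_1 is V_0 shifted by [a], so direction 0 changes only the
    sublattice. *)
Definition move (b : bool) (l : 'I_3) : int * int :=
  match b, nat_of_ord l with
  | false, 1%N => (-1, 1)
  | false, 2 => (-1, 0)
  | true, 1%N => (1, -1)
  | true, 2 => (1, 0)
  | _, _ => (0, 0)
  end.

Definition step (l : 'I_3) (c : hex_code) : hex_code :=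
  (~~ c.1, c.2 + move c.1 l).

(** The predecessor lies on the other sublattice, hence [move (~~ c.1)]. *)
Definition step_back (l : 'I_3) (c : hex_code) : hex_code :=
  (~~ c.1, c.2 - move (~~ c.1) l).

Lemma step_eq l c c' : (step l c == c') = (c == step_back l c').
Proof.
by case: c c' => [[] x] [[] x']; rewrite /step /step_back /= !xpair_eqE //=
  [RHS]eq_sym subr_eq eq_sym.
Qed.

Lemma move_inj b : injective (move b).
Proof.
by case: b => [] [[|[|[|//]]] ?] [[|[|[|//]]] ?] // *; apply: val_inj.
Qed.

Lemma step_inj c : injective (step^~ c).
Proof.
move=> l l' /(congr1 snd) h.
by have /addrI/move_inj : c.2 + move c.1 l = c.2 + move c.1 l' by [].
Qed.

(** In units of [a / 2] the abscissa is the integer [3 * j + 2 * e]: its residue mod 3 gives the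
    sublattice, then [j] follows, and the ordinate gives [k]. *)
Lemma hex_point_inj (a : R) (e e' : bool) (j k j' k' : int) : 0 < a ->
  hex_point a e%:R j k = hex_point a e'%:R j' k' ->
  [/\ e = e', j = j' & k = k'].
Proof.
move=> a_gt0 [].
have s_gt0 : 0 < Num.sqrt 3 :> R by rewrite sqrtr_gt0.
have x_coord z (i : bool) : 3 / 2 * a * z%:~R + i%:R * a
    = a / 2 * (3 * z + 2 * (i : nat)%:Z)%:~R :> R.
  by case: i => /=; field.
have a2_neq0 : a / 2 != 0 by rewrite mulf_neq0 ?invr_eq0 ?pnatr_eq0 ?gt_eqF.
rewrite !x_coord => /(mulfI a2_neq0)/intr_inj hx.
have [ee jj] : e = e' /\ j = j'.
  by case: e e' hx => [] [] /= hx; split => //; lia.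
rewrite jj => /addrI/mulfI; rewrite mulf_neq0 ?gt_eqF // => /(_ isT)/intr_inj.
by split.
Qed.

Lemma vertex_inj (a : R) : 0 < a -> injective (vertex a).
Proof.
move=> a0 [b [j k]] [b' [j' k']].
by move=> /(@hex_point_inj a b b' j k j' k' a0)[/= -> -> ->].
Qed.

Lemma vertex_in (a : R) c : hex_vertices a (sublattice c.1) (vertex a c).
Proof. by exists c.2.1, c.2.2; case: c => [[] ?]. Qed.

Lemma hex_neighbor_vertex (a : R) l c :
  hex_neighbor a (sublattice c.1) l (vertex a c) = vertex a (step l c).
Proof.
case: c => [b [j k]]; rewrite /hex_neighbor /vertex /hex_point /=.
have cos1 : cos (2 * pi * 1 / 3) = - (1 / 2) :> R.
  have -> : 2 * pi * 1 / 3 = - (pi / 3) + pi :> R by field.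
  by rewrite cosDpi cosN cos_pi_third.
have sin1 : sin (2 * pi * 1 / 3) = Num.sqrt 3 / 2 :> R.
  have -> : 2 * pi * 1 / 3 = - (pi / 3) + pi :> R by field.
  by rewrite sinDpi sinN sin_pi_third opprK.
have cos2 : cos (2 * pi * 2%:R / 3) = - (1 / 2) :> R.
  have -> : 2 * pi * 2%:R / 3 = pi / 3 + pi :> R by field.
  by rewrite cosDpi cos_pi_third.
have sin2 : sin (2 * pi * 2%:R / 3) = - (Num.sqrt 3 / 2) :> R.
  have -> : 2 * pi * 2%:R / 3 = pi / 3 + pi :> R by field.
  by rewrite sinDpi sin_pi_third.
case: b l => [] [[|[|[|//]]] ?] /=;
  rewrite ?mulr0 ?mul0r ?mul1r ?addr0 ?mulr0n ?cosDpi ?sinDpi ?cos0 ?sin0;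
  rewrite ?add0r ?cospi ?sinpi ?mulr1n ?cos1 ?sin1 ?cos2 ?sin2;
  congr pair; rewrite ?intrD ?rmorphN /=; lra.
Qed.

Lemma hex_boundary_vertex (a : R) r c : 0 < a ->
  hex_boundary a r (vertex a c) <-> ~~ c.1 && (c.2.1 == r).
Proof.
move=> a0; split; last first.
  by case: c => [[] [j k]] //= /eqP ->; exists k.
case=> k; have -> : hex_point a 0 r k = vertex a (false, (r, k)) by [].
by move/(vertex_inj a a0) => -> /=; rewrite eqxx.
Qed.

End Geometry.

(** * Sums over all paths of a given length *)

Section PathSum.
Context {R : pzRingType}.

(* A path lists its steps from last to first. *)
Fixpoint path_sum (n : nat) (f : seq 'I_3 -> R) : R :=
  if n is m.+1 then path_sum m (fun t => \sum_(l < 3) f (l :: t)) else f [::].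

Lemma eq_path_sum n f g :
  (forall t, size t = n -> f t = g t) -> path_sum n f = path_sum n g.
Proof.
elim: n f g => [|n IH] f g fg /=; first exact: fg.
by apply: IH => t tn; apply: eq_bigr => l _; apply: fg; rewrite /= tn.
Qed.

Lemma path_sumZ n c f : path_sum n (fun t => c * f t) = c * path_sum n f.
Proof.
elim: n f => //= n IH f; rewrite -IH; apply: eq_path_sum => t _.
by rewrite mulr_sumr.
Qed.

Lemma path_sum_sum n (f : 'I_3 -> seq 'I_3 -> R) :
  path_sum n (fun t => \sum_(l < 3) f l t) = \sum_(l < 3) path_sum n (f l).
Proof.
elim: n f => //= n IH f; rewrite -IH; apply: eq_path_sum => t _.
exact: exchange_big.
Qed.

End PathSum.

(** * Endpoints, weights and boundary avoidance of paths *)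

Section Paths.
Context {R : realType} (q : 'I_2 -> 'I_3 -> R) (c0 : hex_code).

Fixpoint endpoint (t : seq 'I_3) : hex_code :=
  if t is l :: t' then step l (endpoint t') else c0.

Fixpoint weight (t : seq 'I_3) : R :=
  if t is l :: t' then q (sublattice (endpoint t').1) l * weight t' else 1.

(** Since the last step comes first, dropping [size t - m] steps keeps the first [m]. *)
Definition position (a : R) (t : seq 'I_3) (m : nat) : R * R :=
  vertex a (endpoint (drop (size t - m) t)).

(** The starting vertex is not tested, since first passage counts positive times only. *)
Fixpoint avoids (r : int) (t : seq 'I_3) : bool :=
  if t is _ :: t' then
    avoids r t' && ~~ (~~ (endpoint t).1 && ((endpoint t).2.1 == r))
  else true.

Lemma avoids_cons r l t (c := endpoint (l :: t)) :
  avoids r (l :: t) = avoids r t && ~~ (~~ c.1 && (c.2.1 == r)).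
Proof. by []. Qed.

Lemma position_cons a l t m :
  (m <= size t)%N -> position a (l :: t) m = position a t m.
Proof. by move=> mt; rewrite /position /= subSn. Qed.

Lemma position_size a t : position a t (size t) = vertex a (endpoint t).
Proof. by rewrite /position subnn drop0. Qed.

Lemma avoidsP a r t : 0 < a -> reflect
  (forall m, (0 < m <= size t)%N -> ~ hex_boundary a r (position a t m))
  (avoids r t).
Proof.
move=> a_gt0; apply: (iffP idP).
  elim: t => [|l t IH]; first by move=> _ [].
  move=> /= /andP[/IH {}IH hit] m /andP[m_gt0].
  rewrite leq_eqVlt => /predU1P[->|mt].
    by rewrite -[(size t).+1]/(size (l :: t)) position_size
      hex_boundary_vertex //; exact/negP.
  by rewrite position_cons //; apply: IH; rewrite m_gt0.
elim: t => [//|l t IH] h /=; apply/andP; split.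
  apply: IH => m /andP[m0 mt]; rewrite -(position_cons a l) //.
  by apply: h; rewrite m0 /= leqW.
apply/negP; rewrite -(hex_boundary_vertex a r (endpoint (l :: t))) //.
by rewrite -position_size; apply: h => /=.
Qed.

End Paths.

(** * From the Markov chain to weighted path sums *)

Section Law.
Context (d : measure_display) (T : measurableType d) (R : realType)
  (P : probability T R) (a : R) (q : 'I_2 -> 'I_3 -> R)
  (X Y : nat -> {RV P >-> R}) (c0 : hex_code).

Let pr (A : set T) : R := fine (P A).
Let cylinder (t : seq 'I_3) : set T := history X Y (size t) (position c0 a t).

Lemma measurable_at_state n z : measurable (at_state X Y n z).
Proof.
have -> : at_state X Y n z = X n @^-1` [set z.1] `&` Y n @^-1` [set z.2].
  by apply/seteqP; split => w; rewrite /at_state /= [z]surjective_pairing /=;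
    [move=> [-> ->] | move=> [-> ->]].
by apply: measurableI; apply: measurable_funPTI; exact: measurable_set1.
Qed.

Lemma measurable_history n z : measurable (history X Y n z).
Proof.
have -> : history X Y n z = \bigcap_(m in `I_n.+1) at_state X Y m (z m).
  by [].
by apply: bigcap_measurableType => m _; exact: measurable_at_state.
Qed.

Lemma prob_splitID A B : measurable A -> measurable B ->
  pr A = pr (A `&` B) + pr (A `\` B).
Proof.
move=> mA mB; rewrite /pr (measureDI P mA mB) fineD ?fin_num_measure //.
- by rewrite addrC.
- exact: measurableD.
- exact: measurableI.
Qed.

Lemma prob_ge0 A : 0 <= pr A. Proof. exact: fine_ge0. Qed.

Lemma le_prob A B : measurable A -> measurable B -> A `<=` B -> pr A <= pr B.
Proof.
move=> mA mB AB; apply: fine_le; rewrite ?fin_num_measure //.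
by apply: le_measure; rewrite ?inE.
Qed.

Lemma cond_probE A B p : measurable A -> measurable B -> (0 < P B)%E ->
  cond_prob P A B = p -> pr (A `&` B) = p * pr B.
Proof.
move=> mA mB PB <-; rewrite /cond_prob mulfVK // gt_eqF // fine_gt0 //.
by rewrite PB /= -ge0_fin_numE // fin_num_measure.
Qed.

(** The laws of the chain are assumed only under conditioning events of positive probability; null
    events need a separate argument. *)
Lemma prob_eq0 A : measurable A -> (0 < P A)%E \/ pr A = 0.
Proof.
move=> mA; have [|/eqP] := boolP (0 < P A)%E; first by left.
right; rewrite /pr; suff -> : P A = 0%E by [].
by apply/eqP; rewrite eq_le measure_ge0 andbT leNgt; exact/eqP.
Qed.

Lemma cylinder_cons l t :
  cylinder (l :: t) =
  at_state X Y (size t).+1 (vertex a (endpoint c0 (l :: t))) `&` cylinder t.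
Proof.
apply/seteqP; split => w h.
  split; first by rewrite -(position_size c0 a (l :: t)); exact: h.
  by move=> m mt; rewrite -(position_cons c0 a l) //; apply: h; exact: leqW.
move=> m; rewrite leq_eqVlt => /predU1P[->|mt].
  by rewrite -/(size (l :: t)) position_size; exact: h.1.
by rewrite position_cons //; exact: h.2.
Qed.

Hypothesis (a_gt0 : 0 < a) (q_sum1 : forall i, \sum_(l < 3) q i l = 1)
  (chain : hex_markov_chain a q X Y).

Lemma prob_cylinder_cons l t :
  pr (cylinder (l :: t)) =
  q (sublattice (endpoint c0 t).1) l * pr (cylinder t).
Proof.
have mC : measurable (cylinder t) by exact: measurable_history.
rewrite cylinder_cons; have [Pt|C0] := prob_eq0 _ mC; last first.
  (* Extending a null cylinder keeps it null, so both sides vanish. *)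
  rewrite C0 mulr0; apply/eqP; rewrite eq_le prob_ge0 andbT -C0.
  by apply: le_prob => //; apply: measurableI => //; exact: measurable_at_state.
apply: cond_probE => //; first exact: measurable_at_state.
rewrite (hex_markov_property chain) // position_size /= -hex_neighbor_vertex.
apply: (hex_transition chain); first exact: vertex_in.
(* The event of the present state contains the cylinder, so it has positive probability too. *)
apply: (lt_le_trans Pt); apply: le_measure; rewrite ?inE //.
  exact: measurable_at_state.
by move=> w /(_ _ (leqnn _)); rewrite position_size.
Qed.

Lemma prob_cylinder t :
  pr (cylinder t) = weight q c0 t * pr (at_state X Y 0 (vertex a c0)).
Proof.
elim: t => [|l t IH]; last by rewrite prob_cylinder_cons IH mulrA.
rewrite mul1r; congr pr; apply/seteqP; split => w; first exact.
by move=> h m; rewrite leqn0 => /eqP ->.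
Qed.

(* The three steps exhaust the law of the next state because q sums to 1. *)
Lemma prob_cylinder_split A t : measurable A ->
  pr (A `&` cylinder t) = \sum_(l < 3) pr (A `&` cylinder (l :: t)).
Proof.
move=> mA; have mC : measurable (cylinder t) by exact: measurable_history.
pose next l := at_state X Y (size t).+1 (vertex a (endpoint c0 (l :: t))).
have mnext l : measurable (next l) by exact: measurable_at_state.
(* Distinct directions lead to distinct vertices, so the events [next l] are disjoint. *)
have next_disj D l l' : l != l' -> (D `\` next l) `&` next l' = D `&` next l'.
  move=> ll'; apply/seteqP; split => w [].
    by move=> [Dw _] wl'.
  move=> Dw wl'; split => //.
  split => // wl; have /(vertex_inj a a_gt0) :
    vertex a (endpoint c0 (l :: t)) = vertex a (endpoint c0 (l' :: t)).
    by rewrite -wl -wl'.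
  by move=> /step_inj l'l; rewrite l'l eqxx in ll'.
have split3 D : measurable D -> pr D =
    \sum_(l < 3) pr (D `&` next l) + pr (D `\` next 0 `\` next 1 `\` next 2).
  move=> mD; rewrite !big_ord_recl big_ord0 addr0.
  rewrite (prob_splitID D (next 0)) // (prob_splitID (_ `\` _) (next 1)) //;
    last exact: measurableD.
  rewrite (prob_splitID (_ `\` _ `\` _) (next 2)) //;
    last by do 2 apply: measurableD => //.
  rewrite !next_disj // -!addrA.
  by congr (pr (_ `&` next _) + (pr (_ `&` next _) + (pr (_ `&` next _) + _)));
    exact: val_inj.
have cyl D l : D `&` cylinder (l :: t) = D `&` cylinder t `&` next l.
  by rewrite cylinder_cons -setIA [cylinder t `&` _]setIC.
rewrite split3; last exact: measurableI.
under eq_bigr do rewrite -cyl; rewrite -[RHS]addr0; congr (_ + _).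
have mD D : measurable D -> measurable (D `\` next 0 `\` next 1 `\` next 2).
  by move=> ?; do 3 apply: measurableD => //.
(* Monotonicity reduces the leftover part to that of the whole cylinder, which is null by comparing
   masses. *)
apply/eqP; rewrite eq_le prob_ge0 andbT.
apply: (@le_trans _ _ (pr (cylinder t `\` next 0 `\` next 1 `\` next 2))).
  apply: le_prob; [by apply: mD; exact: measurableI | exact: mD |].
  by do 3 apply: setSD; exact: subIsetr.
suff : pr (cylinder t) =
    pr (cylinder t) + pr (cylinder t `\` next 0 `\` next 1 `\` next 2) by lra.
rewrite {1}split3 //; congr (_ + _); rewrite -[RHS]mul1r.
rewrite -(q_sum1 (sublattice (endpoint c0 t).1)) mulr_suml.
by apply: eq_bigr => l _; rewrite -prob_cylinder_cons cylinder_cons setIC.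
Qed.

(** Up to null sets the cylinders of length [n] partition the initial event, and each lies inside
    [A] or outside it according to [b]. *)
Lemma prob_path_sum n (A : set T) (b : seq 'I_3 -> bool) : measurable A ->
  (forall t w, size t = n -> cylinder t w -> A w <-> b t) ->
  pr (A `&` at_state X Y 0 (vertex a c0)) =
  pr (at_state X Y 0 (vertex a c0)) *
  path_sum n (fun t => weight q c0 t * (b t)%:R).
Proof.
move=> mA Ab; have -> : pr (A `&` at_state X Y 0 (vertex a c0)) =
    path_sum n (fun t => pr (A `&` cylinder t)).
  elim: n {Ab} => [|n IH] /=.
    congr (pr (A `&` _)); apply/seteqP; split => w; last exact.
    by move=> h m; rewrite leqn0 => /eqP ->.
  by rewrite IH; apply: eq_path_sum => t _; exact: prob_cylinder_split.
rewrite -path_sumZ; apply: eq_path_sum => t tn; rewrite mulrA [pr _ * _]mulrC.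
rewrite -prob_cylinder; have [bt|nbt] := boolP (b t).
  by rewrite mulr1; congr pr; apply/setIidr => w /Ab ->.
rewrite mulr0 (_ : _ `&` _ = set0) ?/pr ?measure0 //.
by apply/seteqP; split => w // [] /[swap] /Ab -> //; exact/negP.
Qed.

Lemma hex_prob0_path_sum n A (b : seq 'I_3 -> bool) :
  (0 < P (at_state X Y 0 (vertex a c0)))%E ->
  measurable A -> ~~ c0.1 ->
  (forall t w, size t = n -> cylinder t w -> A w <-> b t) ->
  hex_prob0 a X Y c0.2.1 c0.2.2 A =
  path_sum n (fun t => weight q c0 t * (b t)%:R).
Proof.
move=> P0 mA c00 /(prob_path_sum _ _ _ mA) h; rewrite /hex_prob0 /cond_prob.
have -> : initial_event a X Y c0.2.1 c0.2.2 = at_state X Y 0 (vertex a c0).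
  by move: c00; rewrite /vertex; case: c0.1.
rewrite -!/(pr _) h mulrC mulKf // gt_eqF // fine_gt0 // P0 /=.
by rewrite -ge0_fin_numE // fin_num_measure //; exact: measurable_at_state.
Qed.

End Law.

(** * The two-step kernel and the reflection principle *)

Section Reflection.
Context {R : realType} (q : 'I_2 -> 'I_3 -> R) (c0 : hex_code).

(** The n-step kernel from [c0] along good paths: free for [xpredT], killed on the boundary for
    [avoids]. *)
Definition law (n : nat) (good : seq 'I_3 -> bool) (c : hex_code) : R :=
  path_sum n (fun t => weight q c0 t * ((endpoint c0 t == c) && good t)%:R).

Lemma law_step n (good good' : seq 'I_3 -> bool) c :
  (forall l t, endpoint c0 (l :: t) = c -> good' (l :: t) = good t) ->
  law n.+1 good' c =
  \sum_(l < 3) q (sublattice (~~ c.1)) l * law n good (step_back l c).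
Proof.
move=> h; rewrite /law /=; under [RHS]eq_bigr do rewrite -path_sumZ.
rewrite -path_sum_sum; apply: eq_path_sum => t _; apply: eq_bigr => l _.
rewrite -mulrA [RHS]mulrCA [LHS]mulrCA step_eq; congr (_ * _).
have [e|ne] := eqVneq (endpoint c0 t) (step_back l c); last by rewrite !mulr0.
rewrite h; last by apply/eqP; rewrite /= step_eq e.
by rewrite e.
Qed.

(** The factors [q 1 _] belong to the last step, out of V_1, and [q 0 _] to the one before; [u] is
    taken at the starts of the nine two-step routes into [(j, k)]. *)
Definition two_step (u : int -> int -> R) (j k : int) : R :=
  q 1 0 * (q 0 0 * u j k + q 0 1 * u (j + 1) (k - 1) + q 0 2 * u (j + 1) k) +
  q 1 1 * (q 0 0 * u (j - 1) (k + 1) + q 0 1 * u j k + q 0 2 * u j (k + 1)) +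
  q 1 2 * (q 0 0 * u (j - 1) k + q 0 1 * u j (k - 1) + q 0 2 * u j k).

Definition law0 n good (j k : int) : R := law n good (false, (j, k)).

(** The condition at odd time concerns endpoints in V_1 only; the boundary lies in V_0, so [avoids]
    satisfies it. *)
Lemma law0_two_step n (good good' good'' : seq 'I_3 -> bool) j k :
  (forall l t, endpoint c0 (l :: t) = (false, (j, k)) ->
     good'' (l :: t) = good' t) ->
  (forall l t, (endpoint c0 (l :: t)).1 -> good' (l :: t) = good t) ->
  law0 n.+2 good'' j k = two_step (law0 n good) j k.
Proof.
move=> h'' h'; rewrite /law0 (law_step _ good') //=.
under eq_bigr => l _.
  rewrite (law_step _ good); last by move=> l' t e; apply: h'; rewrite e.
  over.
rewrite !big_ord_recl !big_ord0 /= /step_back /move /= !addr0.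
have pairB (x y u v : int) : (x, y) - (u, v) = (x - u, y - v) by [].
rewrite /two_step !pairB !opprK !subr0 !subrK !addrK !addrA.
have -> : lift ord0 (lift ord0 ord0) = 2 :> 'I_3 by exact: val_inj.
by have -> : lift ord0 ord0 = 1 :> 'I_3 by exact: val_inj.
Qed.

Hypotheses (q00 : q 0 0 = q 1 0) (q01 : q 0 1 = q 1 2) (q11 : q 1 1 = q 0 2).

(* [(2 * r - j, k + j - r)] is the mirror image of [(j, k)] in the boundary
   column [r]. Mirroring preserves the sublattice of even times, but not the
   hexagonal lattice, so only the two-step kernel can be symmetric. *)
Definition antisym (r : int) (u : int -> int -> R) (j k : int) : R :=
  u j k - u (2 * r - j) (k + j - r).

Lemma antisym_boundary r u k : antisym r u r k = 0.
Proof.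
by rewrite /antisym addrK (_ : 2 * r - r = r) ?subrr // mulr_natl mulr2n addrK.
Qed.

(** The mirror exchanges the shift (1, -1) with (-1, 0) and (1, 0) with (-1, 1), and fixes vertical
    shifts. The hypotheses equate the exchanged weights: [q 1 0 * q 0 1 = q 1 2 * q 0 0] and
    [q 1 0 * q 0 2 = q 1 1 * q 0 0]. *)
Lemma two_step_antisym r u j k :
  two_step (antisym r u) j k = antisym r (two_step u) j k.
Proof.
rewrite /antisym /two_step q00 q01 q11.
have -> : 2 * r - (j + 1) = 2 * r - j - 1 by ring.
have -> : 2 * r - (j - 1) = 2 * r - j + 1 by ring.
have -> : k - 1 + (j + 1) - r = k + j - r by ring.
have -> : k + (j + 1) - r = k + j - r + 1 by ring.
have -> : k + 1 + (j - 1) - r = k + j - r by ring.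
have -> : k - 1 + j - r = k + j - r - 1 by ring.
have -> : k + 1 + j - r = k + j - r + 1 by ring.
have -> : k + (j - 1) - r = k + j - r - 1 by ring.
ring.
Qed.

Definition same_side (r i j : int) : bool :=
  (i < r) && (j < r) || (r < i) && (r < j).

(** Induction by double steps. On the starting side both sides obey the recursion [two_step]; a
    double step shifts the column by at most one, so it cannot jump over the boundary. *)
Lemma law0_avoids r n j k : ~~ c0.1 -> c0.2.1 != r ->
  law0 n.*2 (avoids c0 r) j k =
  if same_side r c0.2.1 j then antisym r (law0 n.*2 xpredT) j k else 0.
Proof.
move=> c00 c0r; elim: n j k => [|n IH] j k.
  rewrite /antisym /law0 /law /= !andbT !mul1r.
  rewrite [c0]surjective_pairing [c0.2]surjective_pairing !xpair_eqE.
  rewrite (negbTE c00) /= /same_side; case: ifPn => side.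
    (* The mirror image of a column on the starting side lies on the far side, so it is not the
       initial column. *)
    rewrite (_ : c0.2.1 == 2 * r - j = false) ?subr0 //.
    by apply/eqP; lia.
  rewrite (_ : c0.2.1 == j = false) //.
  by apply/eqP => e; move/eqP: c0r side; rewrite e; lia.
rewrite doubleS; have [->|jr] := eqVneq j r.
  rewrite /same_side ltxx !andbF /= /law0 /law.
  (* Paths ending on the boundary fail [avoids]; the form [0 * 0] lets [path_sumZ] pull out the
     zero. *)
  transitivity (path_sum n.*2.+2 (fun _ => 0 * 0 : R)).
    apply: eq_path_sum => -[//|l t] _; rewrite mul0r.
    case: eqVneq => [e|_]; last by rewrite mulr0.
    by rewrite avoids_cons e /= eqxx andbF mulr0.
  by rewrite path_sumZ mul0r.
rewrite (law0_two_step _ (avoids c0 r) (avoids c0 r)); first last.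
- by move=> l t e; rewrite avoids_cons e andbT.
- by move=> l t e; rewrite avoids_cons e /= (negbTE jr) andbT.
have [side|noside] := boolP (same_side r c0.2.1 j); last first.
  rewrite /two_step !IH; rewrite /same_side in noside *.
  have -> : (c0.2.1 < r) && (j + 1 < r) || (r < c0.2.1) && (r < j + 1) = false.
    by move/eqP: c0r; move/eqP: jr; lia.
  have -> : (c0.2.1 < r) && (j - 1 < r) || (r < c0.2.1) && (r < j - 1) = false.
    by move/eqP: c0r; move/eqP: jr; lia.
  by rewrite (negbTE noside) !mulr0 !addr0 !mulr0 !addr0.
(* A neighbouring column may be the boundary, where the conditional gives 0; antisymmetry gives 0
   there too, so one formula covers all columns in the recursion. *)
have IH' i l : i = j \/ i = j + 1 \/ i = j - 1 ->
    law0 n.*2 (avoids c0 r) i l = antisym r (law0 n.*2 xpredT) i l.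
  move=> ij; rewrite IH; case: ifPn => // noside.
  have -> : i = r by move: side noside ij; rewrite /same_side; lia.
  by rewrite antisym_boundary.
transitivity (two_step (antisym r (law0 n.*2 xpredT)) j k).
  by rewrite /two_step !IH'; auto.
by rewrite two_step_antisym /antisym -!(law0_two_step _ xpredT xpredT xpredT).
Qed.

End Reflection.

(** * First-passage events read along paths *)

Section FirstPassage.
Context (d : measure_display) (T : measurableType d) (R : realType)
  (P : probability T R) (a : R) (X Y : nat -> {RV P >-> R}) (r : int).

(** Replaces the infimum by conditions at finitely many times, which serves both measurability and
    the reading along a path. *)
Lemma first_passage_at_state m z : (0 < m)%N -> hex_boundary a r z ->
  [set w | first_passage_time a X Y r w = m%:R%:E] `&` at_state X Y m z =
  at_state X Y m z `&`
  \bigcap_(k in [set k | (0 < k < m)%N])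
    ~` [set w | hex_boundary a r (X k w, Y k w)].
Proof.
move=> m_gt0 rz; apply/seteqP; split => w [].
  move=> fpt atz; split=> // k /andP[k_gt0 km] rk.
  have : (first_passage_time a X Y r w <= k%:R%:E)%E.
    by apply: ereal_inf_lbound; exists k.
  by rewrite fpt lee_fin ler_nat leqNgt km.
move=> atz avoid; split=> //; apply/eqP; rewrite eq_le; apply/andP; split.
  by apply: ereal_inf_lbound; exists m => //; split=> //; rewrite atz.
apply: le_ereal_inf_tmp => _ [k [k_gt0 rk] <-].
rewrite lee_fin ler_nat leqNgt; apply/negP => km.
by apply: (avoid k) rk => /=; rewrite k_gt0.
Qed.

Lemma measurable_first_passage m z : (0 < m)%N -> hex_boundary a r z ->
  measurable ([set w | first_passage_time a X Y r w = m%:R%:E] `&`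
              at_state X Y m z).
Proof.
move=> m0 rz; rewrite first_passage_at_state //.
apply: measurableI; first exact: measurable_at_state.
apply: bigcap_measurableType => k _; apply: measurableC.
have -> : [set w | hex_boundary a r (X k w, Y k w)] =
    \bigcup_(i in [set: int]) at_state X Y k (hex_point a 0 r i).
  by apply/seteqP; split => w; [move=> [i]; exists i | move=> [i _]; exists i].
by apply: countable_bigcupT_measurable => // i; exact: measurable_at_state.
Qed.

(** [behead] discards the final step, which must hit the boundary rather than avoid it. *)
Lemma first_passage_cylinder c0 s t w : 0 < a -> (0 < size t)%N ->
  history X Y (size t) (position c0 a t) w ->
  ([set w' | first_passage_time a X Y r w' = (size t)%:R%:E] `&`
     at_state X Y (size t) (hex_point a 0 r s)) w <->
  (endpoint c0 t == (false, (r, s))) && avoids c0 r (behead t).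
Proof.
move=> a_gt0; case: t => [//|l t] _ hw.
rewrite first_passage_at_state //; last by exists s.
have hw' k : (k <= size t)%N -> (X k w, Y k w) = position c0 a t k.
  by move=> kt; rewrite -(position_cons c0 a l) //; apply: hw; exact: leqW.
have endE : at_state X Y (size t).+1 (hex_point a 0 r s) w <->
    endpoint c0 (l :: t) = (false, (r, s)).
  have -> : hex_point a 0 r s = vertex a (false, (r, s)) by [].
  rewrite /at_state /= (hw _ (leqnn _)) position_size.
  by split => [/(vertex_inj a a_gt0)|/= ->].
split=> [[/endE -> avoid]|/andP[/eqP/endE ? /(avoidsP _ _ _ _ a_gt0) avoid]].
  rewrite eqxx; apply/(avoidsP _ _ _ _ a_gt0) => k /andP[k_gt0 kt].
  by rewrite -hw' //; apply: avoid; rewrite /= k_gt0 ltnS.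
split=> // k /andP[k_gt0 kt] /=.
by rewrite hw' //; apply: avoid; rewrite k_gt0.
Qed.

End FirstPassage.

Theorem theorem5p2 (d : measure_display) (T : measurableType d) (R : realType)
  (P : probability T R) (a : R) (q : 'I_2 -> 'I_3 -> R)
  (X Y : nat -> {RV P >-> R})
  (a_gt0 : 0 < a)
  (q_ge0 : forall (i : 'I_2) (l : 'I_3), 0 <= q i l)
  (q_sum1 : forall i : 'I_2, \sum_(l < 3) q i l = 1)
  (chain : hex_markov_chain a q X Y)
  (r : int)
  (q01 : q 0 1 = q 1 2)
  (q11 : q 1 1 = q 0 2)
  (n : nat) (s jt kt : int)
  (init : (0 < P (initial_event a X Y jt kt))%E) :
  let p := state_prob a X Y in
  let g := first_passage_prob a X Y in
  (jt < r ->
     g r s (2 * n + 2)%N jt kt =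
     q 0 0 * (q 1 2 * (p (r - 1) s (2 * n)%N jt kt
                       - p (r + 1) (s - 1) (2 * n)%N jt kt)
              + q 1 1 * (p (r - 1) (s + 1) (2 * n)%N jt kt
                         - p (r + 1) s (2 * n)%N jt kt)))
  /\
  (r < jt ->
     g r s (2 * n + 2)%N jt kt =
     q 1 0 * (q 0 2 * (p (r + 1) s (2 * n)%N jt kt
                       - p (r - 1) (s + 1) (2 * n)%N jt kt)
              + q 0 1 * (p (r + 1) (s - 1) (2 * n)%N jt kt
                         - p (r - 1) s (2 * n)%N jt kt))).
Proof.
move=> p g; pose c0 : hex_code := (false, (jt, kt)).
(* Both rows sum to 1 and their other entries agree in pairs. *)
have q00 : q 0 0 = q 1 0.
  have := q_sum1 0; have := q_sum1 1; rewrite !big_ord_recl !big_ord0.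
  have -> : lift ord0 (lift ord0 ord0) = 2 :> 'I_3 by exact: val_inj.
  have -> : lift ord0 ord0 = 1 :> 'I_3 by exact: val_inj.
  rewrite q01 q11; lra.
have pE j k : p j k (2 * n)%N jt kt = law0 q c0 n.*2 xpredT j k.
  rewrite /p /state_prob /parity mul2n -signr_odd odd_double subrr mul0r.
  apply: (hex_prob0_path_sum _ _ _ _ a q X Y c0) => //.
    exact: measurable_at_state.
  move=> t w <- h; have -> : hex_point a 0 j k = vertex a (false, (j, k)) by [].
  rewrite /at_state /= (h _ (leqnn _)) position_size andbT.
  by split => [/(vertex_inj a a_gt0) ->|/eqP ->].
(* The killed law at time 2n is followed by two steps: the first lands in V_1, off the boundary, and
   the second is exempt from the test. *)
have gE : jt != r -> g r s (2 * n + 2)%N jt kt =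
    two_step q (fun j k => if same_side r jt j then
      antisym r (law0 q c0 n.*2 xpredT) j k else 0) r s.
  move=> jr; rewrite mul2n addn2.
  transitivity (law0 q c0 n.*2.+2 (fun t => avoids c0 r (behead t)) r s).
    apply: (hex_prob0_path_sum _ _ _ _ a q X Y c0) => //.
      by apply: measurable_first_passage => //; exists s.
    move=> t w tn; rewrite -tn; apply: first_passage_cylinder => //.
    by rewrite tn.
  rewrite (law0_two_step _ _ _ (avoids c0 r) (avoids c0 r)) //.
    by rewrite /two_step !law0_avoids.
  by move=> l t e; rewrite avoids_cons e andbT.
have [s1 s2 s3 s4] : [/\ s + 1 + (r - 1) - r = s, s + (r - 1) - r = s - 1,
    s - 1 + (r + 1) - r = s & s + (r + 1) - r = s + 1] by split; ring.
have mirror1 : 2 * r - (r - 1) = r + 1 by ring.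
have mirror2 : 2 * r - (r + 1) = r - 1 by ring.
(* Terms in column [r] and on the far side vanish. Two routes remain, from the adjacent column on
   the starting side, and the mirror maps that column to the opposite one. *)
split=> jr; (rewrite gE; last by rewrite ?(lt_eqF jr) ?(gt_eqF jr));
  rewrite !pE /two_step /same_side ltxx !andbF jr (lt_gtF jr) /=.
  have -> : r + 1 < r = false by lia.
  have -> : r - 1 < r by lia.
  by rewrite /= /antisym mirror1 s1 s2; ring.
have -> : r < r + 1 by lia.
have -> : r < r - 1 = false by lia.
by rewrite /= /antisym mirror2 s3 s4; ring.
Qed.
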